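(* Let $(\mathbf{C},\mathscr{T},\mathbf{S},\ell)$ be a tuple satisfying the hypotheses, including conditions (a)–(f), listed in the context, with the index set $\mathbb{L}$, the elements $\nu^{(j)}\in\Lambda$ and the subsets $\Lambda_j\subset\Lambda$ ($j\in\mathbb{L}$) defined there. (i) The decategorification map $\mathrm{Ob}:\mathrm{TId}(\mathbf{C})\to\mathrm{Id}([\mathbf{C}]_\oplus)$ is an isomorphism (of partially ordered sets). (ii) One has $\mathrm{Id}([\mathbf{C}]_\oplus)=\{I_i\mid i\in\mathbb{L}\}$ with $\mathrm{Ob}\,\mathbf{C}=I_0\supsetneq I_1\supsetneq I_2\supsetneq\cdots$ and, for $\lambda\in\Lambda$, $$R(\lambda)\in I_i\iff\lambda\succeq\mu\ \text{ for some }\mu\in\Lambda_i.$$ (iii) For $i,j\in\mathbb{L}$ and $\mathcal{J}_i:=\mathrm{Ob}^{-1}(I_i)$, $$\mathcal{J}_i(\mathbf 1,R(\nu^{(j)}))=\begin{cases}\mathbf{C}(\mathbf 1,R(\nu^{(j)}))\cong\Bbbk&\text{if }i\le j,\\0&\text{if }i>j.\end{cases}$$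
   Context: General notions. Categories are essentially small; monoidal categories are preadditive with bi-additive $\otimes$ and unit $\mathbf 1$. Krull-Schmidt: additive, every object is a finite direct sum of indecomposables, indecomposables have local endomorphism rings. $\mathrm{Ob}\,\mathbf{C}$ is the class of objects of $\mathbf{C}$ and $\mathrm{inde}\,\mathbf{C}$ is the set of isomorphism classes of indecomposable objects. Right rigid: every object $X$ has a right dual $(X^\vee,\ \mathrm{ev}_X:X\otimes X^\vee\to\mathbf 1,\ \mathrm{co}_X:\mathbf 1\to X^\vee\otimes X)$ satisfying the two zig-zag identities. Write $X\mid Y$ for ''$X$ is (isomorphic to) a direct summand of $Y$''. A left-tensor ideal $\mathcal{J}$ consists of subgroups $\mathcal{J}(X,Y)\subset\mathbf{C}(X,Y)$ closed under composition with arbitrary morphisms on both sides and under $1_Z\otimes-$ for all $Z$; $\mathrm{TId}(\mathbf{C})$ is the poset of these, ordered by inclusion. $\mathrm{Id}([\mathbf{C}]_\oplus)$ is the poset of thick left-tensor $\mathrm{Ob}$-ideals: isomorphism-closed sets $I$ of objects with $X\oplus Y\in I$ iff $X,Y\in I$, and $X\in I\Rightarrow Y\otimes X\in I$ for all $Y$; these are identified with the left ideals of the split Grothendieck ring $[\mathbf C]_\oplus$ generated as abelian groups by classes of indecomposable objects. $\mathrm{Ob}(\mathcal{J})=\{X\mid 1_X\in\mathcal{J}(X,X)\}$. The data. - $(\mathbf{S},\ell)$ is an $l$-controlled monoidal category: $\mathbf{S}$ is a Krull-Schmidt monoidal category with $\mathbf{S}(\mathbf 1,\mathbf 1)$ a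 field, and with $\Lambda:=\mathrm{inde}\,\mathbf{S}$, $\ell:\Lambda\to\mathbb{N}$ is a map with $\ell^{-1}(0)=\{\mathbf 1\}$ such that $\kappa\mid\mu\otimes\lambda$ implies $\ell(\kappa)=\ell(\mu)+\ell(\lambda)$ for all $\kappa,\lambda,\mu\in\Lambda$. Define a partial order on $\Lambda$ by: $\lambda\preceq\nu$ iff $\nu\mid\mu\otimes\lambda$ for some $\mu\in\Lambda$. - $\mathbf{C}$ is a right rigid Krull-Schmidt monoidal category such that $\Bbbk:=\mathbf{C}(\mathbf 1,\mathbf 1)$ is a field and all $\mathbf{C}(X,Y)$ are finitely generated over $\Bbbk$. - $\mathscr{T}:\mathbf{S}\to\mathbf{C}$ is a monoidal functor. Let $\mathsf{B}$ be the set of $X\in\mathrm{inde}\,\mathbf{C}$ with $\mathbf{C}(\mathbf 1,X)\ne0$. The conditions are: (a) There is a bijection $\Lambda\to\mathrm{inde}\,\mathbf{C}$, $\lambda\mapsto R(\lambda)$, with $\mathscr{T}(\lambda)\cong R(\lambda)\oplus X$ for some object $X$ such that $R(\mu)\mid X$ implies $\mu\prec\lambda$. (b) There is a map $\phi:\Lambda\to\Lambda$ with $\ell\circ\phi=\ell$ such that $R(\lambda)^\vee\cong R(\phi(\lambda))$ for all $\lambda\in\Lambda$. (c) Distinct elements $R(\nu)\neq R(\nu')$ of $\mathsf{B}$ satisfy $\ell(\nu)\ne\ell(\nu')$. Set $\mathbb{L}=\{0,1,\dots,n\}$ if $|\mathsf{B}|=n+1<\infty$ and $\mathbb{L}=\mathbb{N}$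 otherwise, and label $\mathsf{B}=\{R(\nu^{(j)})\mid j\in\mathbb{L}\}$ with $0=\ell(\nu^{(0)})<\ell(\nu^{(1)})<\ell(\nu^{(2)})<\cdots$. (d) For each $j\in\mathbb{L}$ the set $\Lambda_j:=\{\lambda\in\Lambda\mid\nu^{(j)}\text{ is a direct summand of }\phi(\lambda)\otimes\lambda\}$ is non-empty, and $\lambda\in\Lambda_j$ implies $\mathbf{C}(R(\lambda),R(\lambda))=\Bbbk$. (e) If $j<j'$ in $\mathbb{L}$, then for each $\lambda'\in\Lambda_{j'}$ there is $\lambda\in\Lambda_j$ with $\lambda\prec\lambda'$. (f) If for some $\lambda\in\Lambda$ and $j\in\mathbb{L}$ there is $\kappa\in\Lambda$ with $\nu^{(j)}\preceq\kappa$ and $\kappa\mid\phi(\lambda)\otimes\lambda$, then there is $\mu\in\Lambda_j$ with $\mu\preceq\lambda$.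
   Formalization: In (ii), the set {I_i} is shown to be the set of nonzero thick ideals, since the ideal of zero objects lies in Id([C]_⊕) but is never an I_i; thick ideals are taken to contain the zero objects (excluding the empty set), and monoidal functors are taken to be additive. *)

(* Defs.v *)
From HB Require Import structures.
From mathcomp Require Import all_boot all_order all_algebra.
From mathcomp Require Import boolp classical_sets functions cardinality.

Set Implicit Arguments.
Unset Strict Implicit.
Unset Printing Implicit Defensive.

Import GRing.Theory.
Local Open Scope classical_set_scope.
Local Open Scope card_scope.
Local Open Scope ring_scope.

Reserved Notation "g '\oc' f" (at level 40, left associativity).
Reserved Notation "X '\ox' Y" (at level 40, left associativity).
Reserved Notation "f '\oxm' g" (at level 40, left associativity).

(* The objects form a type, so smallness is relative to an ambient universe. *)
Record preaddCat := PreaddCat {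
  ob :> Type;
  hom : ob -> ob -> zmodType;
  idm : forall X, hom X X;
  comp : forall X Y Z, hom Y Z -> hom X Y -> hom X Z;
  compA : forall W X Y Z (h : hom Y Z) (g : hom X Y) (f : hom W X),
    comp h (comp g f) = comp (comp h g) f;
  comp1m : forall X Y (f : hom X Y), comp (idm Y) f = f;
  compm1 : forall X Y (f : hom X Y), comp f (idm X) = f;
  compDl : forall X Y Z (g g' : hom Y Z) (f : hom X Y),
    comp (g + g') f = comp g f + comp g' f;
  compDr : forall X Y Z (g : hom Y Z) (f f' : hom X Y),
    comp g (f + f') = comp g f + comp g f'
}.
Arguments hom {p} X Y.
Arguments idm {p} X.
Arguments comp {p X Y Z} g f.
Notation "g \oc f" := (comp g f).

Section Preadditive.
Variable C : preaddCat.
Implicit Types X Y Z : C.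

Definition is_iso X Y (f : hom X Y) :=
  exists g : hom Y X, g \oc f = idm X /\ f \oc g = idm Y.

Definition iso X Y := exists f : hom X Y, is_iso f.

Definition is_zero X := idm X = 0.

(* [is_dsum X Y Z] says that Z is isomorphic to X (+) Y. *)
Definition is_dsum X Y Z :=
  exists (i1 : hom X Z) (i2 : hom Y Z) (p1 : hom Z X) (p2 : hom Z Y),
  [/\ p1 \oc i1 = idm X, p2 \oc i2 = idm Y, p1 \oc i2 = 0, p2 \oc i1 = 0
    & i1 \oc p1 + i2 \oc p2 = idm Z].

Definition is_big_dsum n (X : 'I_n -> C) Z :=
  exists (i : forall k, hom (X k) Z) (p : forall k, hom Z (X k)),
  [/\ forall k, p k \oc i k = idm (X k),
      forall j k, j != k -> p j \oc i k = 0
    & \sum_(k < n) (i k \oc p k) = idm Z].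

Definition summand X Y := exists Z, is_dsum X Z Y.

Definition indecomposable X :=
  ~ is_zero X /\ forall Y Z, is_dsum Y Z X -> is_zero Y \/ is_zero Z.

Definition additive_cat :=
  (exists Z, is_zero Z) /\ forall X Y, exists Z, is_dsum X Y Z.

Definition local_end X :=
  idm X != 0 /\
  forall f g : hom X X, ~ is_iso f -> ~ is_iso g -> ~ is_iso (f + g).

Definition krull_schmidt :=
  [/\ additive_cat,
      forall Z, exists n (X : 'I_n -> C),
        (forall k, indecomposable (X k)) /\ is_big_dsum X Z
    & forall X, indecomposable X -> local_end X].

(* An element of [inde] is an isomorphism class, as a set of objects. *)
Record inde := Inde {
  iclass : set C;
  iclassP : exists2 X, indecomposable X & iclass = [set Y | iso X Y]
}.

(* A chosen representative; every use below is isomorphism invariant. *)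
Definition rep (x : inde) : C := s2val (cid2 (iclassP x)).

Lemma iso_refl X : iso X X.
Proof. by exists (idm X), (idm X); rewrite comp1m. Qed.

Lemma iso_sym X Y : iso X Y -> iso Y X.
Proof. by move=> [f [g [gf fg]]]; exists g, f. Qed.

Lemma iso_trans X Y Z : iso X Y -> iso Y Z -> iso X Z.
Proof.
move=> [f [g [gf fg]]] [h [k [kh hk]]]; exists (h \oc f), (g \oc k); split.
  by rewrite -compA (compA k) kh comp1m.
by rewrite -compA (compA f) fg comp1m.
Qed.

Lemma rep_indecomposable (x : inde) : indecomposable (rep x).
Proof. exact: (s2valP (cid2 (iclassP x))). Qed.

Lemma iclassE (x : inde) : iclass x = [set Y | iso (rep x) Y].
Proof. exact: (s2valP' (cid2 (iclassP x))). Qed.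

Lemma inde_eqP (x y : inde) : x = y <-> iso (rep x) (rep y).
Proof.
split=> [->|xy]; first exact: iso_refl.
have : iclass x = iclass y.
  rewrite !iclassE; apply/seteqP; split=> Z /= h.
    exact: iso_trans (iso_sym xy) h.
  exact: iso_trans xy h.
case: x y {xy} => [A HA] [B HB] /= AB; rewrite AB in HA *.
by congr Inde; exact: Prop_irrelevance.
Qed.

Lemma inde_surj X : indecomposable X -> exists x : inde, iso (rep x) X.
Proof.
move=> iX; pose x := @Inde [set Y | iso X Y] (ex_intro2 _ _ X iX erefl).
exists x; have : iclass x X by exact: iso_refl.
by rewrite iclassE.
Qed.

End Preadditive.

Arguments rep {C} x.

Record monoidalCat := MonoidalCat {
  mcat :> preaddCat;
  unit_ob : mcat;
  tens : mcat -> mcat -> mcat;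
  tensm : forall X X' Y Y' : mcat,
    hom X X' -> hom Y Y' -> hom (tens X Y) (tens X' Y');
  tensm1 : forall X Y, tensm (idm X) (idm Y) = idm (tens X Y);
  tensm_comp : forall X X' X'' Y Y' Y'' (f' : hom X' X'') (f : hom X X')
      (g' : hom Y' Y'') (g : hom Y Y'),
    tensm (f' \oc f) (g' \oc g) = tensm f' g' \oc tensm f g;
  tensmDl : forall X X' Y Y' (f f' : hom X X') (g : hom Y Y'),
    tensm (f + f') g = tensm f g + tensm f' g;
  tensmDr : forall X X' Y Y' (f : hom X X') (g g' : hom Y Y'),
    tensm f (g + g') = tensm f g + tensm f g';
  assoc : forall X Y Z, hom (tens (tens X Y) Z) (tens X (tens Y Z));
  assocV : forall X Y Z, hom (tens X (tens Y Z)) (tens (tens X Y) Z);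
  assocK : forall X Y Z, assocV X Y Z \oc assoc X Y Z = idm _;
  assocVK : forall X Y Z, assoc X Y Z \oc assocV X Y Z = idm _;
  assoc_nat : forall X X' Y Y' Z Z'
      (f : hom X X') (g : hom Y Y') (h : hom Z Z'),
    assoc X' Y' Z' \oc tensm (tensm f g) h
    = tensm f (tensm g h) \oc assoc X Y Z;
  lunit : forall X, hom (tens unit_ob X) X;
  lunitV : forall X, hom X (tens unit_ob X);
  lunitK : forall X, lunitV X \oc lunit X = idm _;
  lunitVK : forall X, lunit X \oc lunitV X = idm _;
  lunit_nat : forall X Y (f : hom X Y),
    lunit Y \oc tensm (idm unit_ob) f = f \oc lunit X;
  runit : forall X, hom (tens X unit_ob) X;
  runitV : forall X, hom X (tens X unit_ob);
  runitK : forall X, runitV X \oc runit X = idm _;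
  runitVK : forall X, runit X \oc runitV X = idm _;
  runit_nat : forall X Y (f : hom X Y),
    runit Y \oc tensm f (idm unit_ob) = f \oc runit X;
  pentagon : forall W X Y Z,
    assoc W X (tens Y Z) \oc assoc (tens W X) Y Z
    = tensm (idm W) (assoc X Y Z) \oc assoc W (tens X Y) Z
      \oc tensm (assoc W X Y) (idm Z);
  triangle : forall X Y,
    tensm (idm X) (lunit Y) \oc assoc X unit_ob Y
    = tensm (runit X) (idm Y)
}.
Arguments unit_ob {m}.
Arguments tens {m} X Y.
Arguments tensm {m X X' Y Y'} f g.
Arguments assoc {m} X Y Z.
Arguments assocV {m} X Y Z.
Arguments lunit {m} X.
Arguments lunitV {m} X.
Arguments runit {m} X.
Arguments runitV {m} X.
Notation "X \ox Y" := (tens X Y).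
Notation "f \oxm g" := (tensm f g).

(* Additive on morphisms, as all functors between preadditive categories here. *)
Record monoidalFunctor (S C : monoidalCat) := MonoidalFunctor {
  fob :> S -> C;
  fmap : forall X Y : S, hom X Y -> hom (fob X) (fob Y);
  fmap1 : forall X, fmap (idm X) = idm (fob X);
  fmap_comp : forall X Y Z (g : hom Y Z) (f : hom X Y),
    fmap (g \oc f) = fmap g \oc fmap f;
  fmapD : forall X Y (f g : hom X Y), fmap (f + g) = fmap f + fmap g;
  ftens : forall X Y, hom (fob X \ox fob Y) (fob (X \ox Y));
  ftens_iso : forall X Y, is_iso (ftens X Y);
  ftens_nat : forall X X' Y Y' (f : hom X X') (g : hom Y Y'),
    ftens X' Y' \oc (fmap f \oxm fmap g) = fmap (f \oxm g) \oc ftens X Y;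
  funit : hom unit_ob (fob unit_ob);
  funit_iso : is_iso funit;
  ftens_assoc : forall X Y Z,
    fmap (assoc X Y Z) \oc ftens (X \ox Y) Z \oc (ftens X Y \oxm idm (fob Z))
    = ftens X (Y \ox Z) \oc (idm (fob X) \oxm ftens Y Z)
      \oc assoc (fob X) (fob Y) (fob Z);
  ftens_lunit : forall X,
    fmap (lunit X) \oc ftens unit_ob X \oc (funit \oxm idm (fob X))
    = lunit (fob X);
  ftens_runit : forall X,
    fmap (runit X) \oc ftens X unit_ob \oc (idm (fob X) \oxm funit)
    = runit (fob X)
}.

Section Monoidal.
Variable C : monoidalCat.
Implicit Types X Y Z : C.

Definition unit_field :=
  [/\ idm (unit_ob : C) != 0,
      forall a b : hom (unit_ob : C) unit_ob, a \oc b = b \oc a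
    & forall a : hom (unit_ob : C) unit_ob, a != 0 -> is_iso a].

(* The action of the scalars C(1,1) on C(X,Y): f.a = f (x) a, transported along
   the right unitors.  It makes composition and all functors Z (x) - bilinear,
   resp. linear.  On C(1,Y) it is precomposition with a. *)
Definition scal X Y (f : hom X Y) (a : hom unit_ob unit_ob) : hom X Y :=
  runit Y \oc (f \oxm a) \oc runitV X.

Definition fin_gen X Y :=
  exists n (e : 'I_n -> hom X Y), forall f : hom X Y,
  exists a : 'I_n -> hom (unit_ob : C) unit_ob, f = \sum_(k < n) scal (e k) (a k).

Definition scalar_iso X Y :=
  exists h : hom (unit_ob : C) unit_ob -> hom X Y,
  [/\ bijective h, forall a b, h (a + b) = h a + h b
    & forall a b, h (a \oc b) = scal (h a) b].

(* C(X,X) = C(1,1): the structure map from the scalars is bijective. *)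
Definition scalar_end X :=
  bijective (fun a : hom (unit_ob : C) unit_ob => scal (idm X) a).

Record right_dual X := RightDual {
  dual : C;
  ev : hom (X \ox dual) unit_ob;
  co : hom unit_ob (dual \ox X);
  zigzag_l : (ev \oxm idm X) \oc assocV X dual X \oc (idm X \oxm co)
    = lunitV X \oc runit X;
  zigzag_r : (idm dual \oxm ev) \oc assoc dual X dual \oc (co \oxm idm dual)
    = runitV dual \oc lunit dual
}.

Definition right_rigid := forall X, right_dual X.

Record TId := LeftTensorIdeal {
  tid :> forall X Y, set (hom X Y);
  tid0 : forall X Y, tid (0 : hom X Y);
  tidB : forall X Y (f g : hom X Y), tid f -> tid g -> tid (f - g);
  tid_compl : forall X Y Z (g : hom Y Z) (f : hom X Y), tid f -> tid (g \oc f);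
  tid_compr : forall X Y Z (g : hom Y Z) (f : hom X Y), tid g -> tid (g \oc f);
  tid_tens : forall X Y Z (f : hom X Y), tid f -> tid (idm Z \oxm f)
}.

(* Thick left-tensor Ob-ideals.  They contain the zero objects, as they
   correspond to subgroups of the split Grothendieck ring; this only excludes
   the empty set of objects. *)
Record Id := ThickIdeal {
  thick :> C -> Prop;
  thick0 : forall X, is_zero X -> thick X;
  thick_iso : forall X Y, iso X Y -> thick X -> thick Y;
  thick_dsum : forall X Y Z, is_dsum X Y Z -> (thick Z <-> thick X /\ thick Y);
  thick_tens : forall X Y, thick X -> thick (Y \ox X)
}.

Definition le_TId (J J' : TId) := forall X Y, J X Y `<=` J' X Y.
Definition le_Id (I I' : Id) := (I : set C) `<=` (I' : set C).

Section ObMap.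
Variable J : TId.

Let ObJ : set C := [set X | J X X (idm X)].

Fact ObJ0 X : is_zero X -> ObJ X.
Proof. by rewrite /is_zero /ObJ /= => ->; exact: tid0. Qed.

Lemma ObJ_retract X Y (f : hom X Y) (g : hom Y X) :
  f \oc g = idm Y -> ObJ X -> ObJ Y.
Proof.
move=> fg JX; rewrite /ObJ /= -fg -[f in f \oc g]compm1.
by apply: tid_compr; apply: tid_compl.
Qed.

Fact ObJ_iso X Y : iso X Y -> ObJ X -> ObJ Y.
Proof. by move=> [f [g [_ fg]]]; exact: ObJ_retract fg. Qed.

Fact ObJ_dsum X Y Z : is_dsum X Y Z -> (ObJ Z <-> ObJ X /\ ObJ Y).
Proof.
move=> [i1 [i2 [p1 [p2 [pi1 pi2 _ _ ip]]]]]; split=> [JZ|[JX JY]].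
  by split; [exact: ObJ_retract pi1 JZ | exact: ObJ_retract pi2 JZ].
rewrite /ObJ /= -ip -[i2 \oc p2]opprK; apply: tidB.
  by rewrite -[i1]compm1; apply: tid_compr; apply: tid_compl.
rewrite -[X in J _ _ X]add0r; apply: tidB; first exact: tid0.
by rewrite -[i2]compm1; apply: tid_compr; apply: tid_compl.
Qed.

Fact ObJ_tens X Y : ObJ X -> ObJ (Y \ox X).
Proof. by rewrite /ObJ /= -tensm1; exact: tid_tens. Qed.

Definition Ob : Id := ThickIdeal ObJ0 ObJ_iso ObJ_dsum ObJ_tens.

End ObMap.

(* The ideal of zero objects belongs to [Id], but contains no indecomposable
   object, so a classification by non-empty sets of classes must leave it out. *)
Definition nonzero_Id (I : Id) := exists2 X, I X & ~ is_zero X.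

Definition prec (l n : inde C) :=
  exists m : inde C, summand (rep n) (rep m \ox rep l).

Definition sprec (l n : inde C) := prec l n /\ l <> n.

Definition l_controlled (ell : inde C -> nat) :=
  [/\ krull_schmidt C, unit_field,
      forall l : inde C, ell l = 0%N <-> iso (rep l) unit_ob
    & forall k l m : inde C,
        summand (rep k) (rep m \ox rep l) -> ell k = (ell m + ell l)%N].

Definition with_invariants : set (inde C) :=
  [set x | exists f : hom unit_ob (rep x), f != 0].

Definition dual_summand_set (phi : inde C -> inde C) (n : inde C) :
    set (inde C) :=
  [set l | summand (rep n) (rep (phi l) \ox rep l)].

End Monoidal.

Arguments with_invariants C _ : clear implicits.

Definition poset_iso (A B : Type) (leA : A -> A -> Prop) (leB : B -> B -> Prop)
    (f : A -> B) :=
  bijective f /\ forall x y, leA x y <-> leB (f x) (f y).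

(* {0, ..., n} if B has n + 1 elements, and all of nat if B is infinite. *)
Definition label_set (T : Type) (B : set T) : set nat :=
  [set j | infinite_set B \/ exists2 n, B #= `I_n.+1 & (j <= n)%N].

(* Main.v *)
From mathcomp Require Import all_boot all_order all_algebra.
From mathcomp Require Import boolp classical_sets functions cardinality.
Require Import Defs.

Set Implicit Arguments.
Unset Strict Implicit.
Unset Printing Implicit Defensive.

Import GRing.Theory.
Local Open Scope classical_set_scope.
Local Open Scope ring_scope.

(** Everything is read off the functor C(1,-).  Since objects have right duals,
    transposition C(X,Y) = C(1, X^v (x) Y) stays inside a left-tensor ideal
    ([tid_transpose]); decomposing the target, an ideal is determined by what it
    contains of the spaces C(1,Z) with Z indecomposable ([le_TId_unit]), that is,
    of the spaces C(1, R(nu j)).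

    For l in Lambda_j, lengths show that R(nu j) is a summand of R(l)^v (x) R(l)
    ([top_retract]): the other summands of T(phi l) and T(l) are shorter and
    cannot reach the length of nu j.  As End R(l) is the field C(1,1), all maps
    1 -> R(l)^v (x) R(l) are multiples of the coevaluation.  Hence C(1, R(nu j)) is
    one-dimensional, spanned by some g_j, and g_j and the coevaluation of R(l)
    divide each other: an ideal J contains the identity of R(l) if and only if it
    contains g_j ([Ob_unit_gen]).  So J is given by the set of labels j with g_j in
    J, and this set can be recovered from Ob(J); this is injectivity of Ob, and
    also that its inverse preserves inclusion.  Surjectivity is general: the
    morphisms that factor through objects of a thick ideal I form an ideal whose
    objects are retracts of objects of I, hence in I ([Ob_factor_ideal]).

    It remains to see which sets of labels occur.  By [he] and the description of
    top summands they are closed upwards ([unit_gen_upward]).  Conversely the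
    ideal J_i generated by g_i contains no g_j with j < i
    ([threshold_ideal_below]): on C(1,-) this ideal consists of the composites
    h g_i, and if h g_i spanned C(1, R(nu j)), then upward closure would give
    g_i = h' h g_i, so h' h would be invertible in the local ring End R(nu i) and
    R(nu i) would be a retract of R(nu j).  So the nonzero ideals are exactly the
    J_i, with i the least label.  Finally, if R(l) belongs to J_i, its coevaluation
    has a nonzero component in some C(1, R(nu j)) with j >= i, so R(nu j) is a
    summand of R(l)^v (x) R(l), and [hf] followed by [he] yields an element of Lambda_i
    below l ([threshold_Ob]). *)

(** * Retracts and direct sums *)

Lemma dep_ord_cons n (A : 'I_n.+1 -> Type) (a0 : A ord0)
    (a : forall m, A (lift ord0 m)) :
  exists f : forall k, A k, f ord0 = a0 /\ forall m, f (lift ord0 m) = a m.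
Proof.
exists (fun k => match unliftP ord0 k with
  | UnliftSome m e => eq_rect_r A (a m) e
  | UnliftNone e => eq_rect_r A a0 e end).
split=> [|m]; case: unliftP => [m' e|e].
- by exfalso; have := neq_lift ord0 m'; rewrite -e eqxx.
- by rewrite (Prop_irrelevance e erefl).
- have em := lift_inj e; case: m' / em e => e.
  by rewrite (Prop_irrelevance e erefl).
- by exfalso; have := neq_lift ord0 m; rewrite e eqxx.
Qed.

Section Preadditive.
Variable C : preaddCat.
Implicit Types X Y Z W : C.

Lemma comp0l X Y Z (f : hom X Y) : (0 : hom Y Z) \oc f = 0.
Proof. by apply: (addIr (0 \oc f)); rewrite -compDl !add0r. Qed.

Lemma comp0r X Y Z (g : hom Y Z) : g \oc (0 : hom X Y) = 0.
Proof. by apply: (addIr (g \oc 0)); rewrite -compDr !add0r. Qed.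

Lemma compNl X Y Z (g : hom Y Z) (f : hom X Y) : (- g) \oc f = - (g \oc f).
Proof. by apply: (addIr (g \oc f)); rewrite -compDl !addNr comp0l. Qed.

Lemma compNr X Y Z (g : hom Y Z) (f : hom X Y) : g \oc (- f) = - (g \oc f).
Proof. by apply: (addIr (g \oc f)); rewrite -compDr !addNr comp0r. Qed.

Lemma comp_suml X Y Z n (g : 'I_n -> hom Y Z) (f : hom X Y) :
  (\sum_(k < n) g k) \oc f = \sum_(k < n) (g k \oc f).
Proof.
elim: n g => [|n IH] g; first by rewrite !big_ord0 comp0l.
by rewrite !big_ord_recl compDl IH.
Qed.

Lemma comp_sumr X Y Z n (g : hom Y Z) (f : 'I_n -> hom X Y) :
  g \oc (\sum_(k < n) f k) = \sum_(k < n) (g \oc f k).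
Proof.
elim: n f => [|n IH] f; first by rewrite !big_ord0 comp0r.
by rewrite !big_ord_recl compDr IH.
Qed.

(** Retracts replace direct summands as the working notion: they are visibly
    transitive and preserved by functors and tensor products, and for an
    indecomposable X both notions agree ([retract_summand]). *)
Definition retract X Y :=
  exists (i : hom X Y) (p : hom Y X), p \oc i = idm X.

Lemma retract_trans Y X Z : retract X Y -> retract Y Z -> retract X Z.
Proof.
move=> [i [p pi]] [j [q qj]]; exists (j \oc i), (p \oc q).
by rewrite compA -(compA p q j) qj compm1.
Qed.

Lemma iso_retract X Y : iso X Y -> retract X Y.
Proof. by move=> [f [g [gf _]]]; exists f, g. Qed.

Lemma summand_retract X Y : summand X Y -> retract X Y.
Proof. by move=> [Z [i [_ [p [_ [pi _ _ _ _]]]]]]; exists i, p. Qed.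

Lemma dsum_retractl X Y Z : is_dsum X Y Z -> retract X Z.
Proof. by move=> XYZ; apply: summand_retract; exists Y. Qed.

(** A direct sum of the remaining terms is a complement of the k-th one.  This is
    how binary sums, the only ones in the definitions of summands and of thick
    ideals, are obtained from Krull-Schmidt decompositions. *)
Lemma big_dsumD1 n (X : 'I_n.+1 -> C) (k : 'I_n.+1) Z W :
  is_big_dsum X Z -> is_big_dsum (fun m => X (lift k m)) W ->
  is_dsum (X k) W Z.
Proof.
move=> [i [p [pi pi0 ip]]] [j [q [qj qj0 jq]]].
pose a := \sum_(m < n) (i (lift k m) \oc q m).
pose b := \sum_(m < n) (j m \oc p (lift k m)).
have pa m : p (lift k m) \oc a = q m.
  rewrite comp_sumr (bigD1 m) //= big1 => [|m' m'm].
    by rewrite compA pi comp1m addr0.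
  by rewrite compA pi0 ?comp0l // (inj_eq lift_inj) eq_sym.
exists (i k), a, (p k), b; split=> //.
- rewrite comp_suml -[RHS]jq; apply: eq_bigr => m _.
  by rewrite -compA pa.
- by rewrite comp_sumr big1 // => m _; rewrite compA pi0 ?comp0l ?neq_lift.
- rewrite comp_suml big1 // => m _.
  by rewrite -compA pi0 ?comp0r // eq_sym neq_lift.
rewrite -[RHS]ip (bigD1_ord k) //=; congr (_ + _).
rewrite comp_suml; apply: eq_bigr => m _.
rewrite -compA; congr (_ \oc _).
rewrite comp_sumr (bigD1 m) //= big1 => [|m' m'm].
  by rewrite compA qj comp1m addr0.
by rewrite compA qj0 ?comp0l // eq_sym.
Qed.

Lemma big_dsum_exists n (X : 'I_n -> C) :
  additive_cat C -> exists Z, is_big_dsum X Z.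
Proof.
move=> [[O O0] addC]; elim: n X => [|n IH] X.
  exists O, (fun k => 0), (fun k => 0); split=> [[]//|[]//|].
  by rewrite big_ord0.
have [W [i [p [pi pi0 ip]]]] := IH (fun m => X (lift ord0 m)).
have [Z [i1 [i2 [p1 [p2 [pi1 pi2 pi12 pi21 ipZ]]]]]] := addC (X ord0) W.
have [I [I0 IS]] := dep_ord_cons (A := fun k => hom (X k) Z) i1
  (fun m => i2 \oc i m).
have [P [P0 PS]] := dep_ord_cons (A := fun k => hom Z (X k)) p1
  (fun m => p m \oc p2).
exists Z, I, P; split=> [k|j k|].
- case: (unliftP ord0 k) => [m ->|->]; last by rewrite I0 P0.
  by rewrite IS PS compA -(compA _ p2) pi2 compm1.
- case: (unliftP ord0 k) => [m ->|->]; case: (unliftP ord0 j) => [m' ->|->].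
  + rewrite (inj_eq lift_inj) IS PS compA -(compA _ p2) pi2 compm1.
    exact: pi0.
  + by rewrite IS P0 compA pi12 comp0l.
  + by rewrite I0 PS -compA pi21 comp0r.
  + by rewrite eqxx.
rewrite big_ord_recl I0 P0 -[RHS]ipZ; congr (_ + _).
rewrite -[p2]comp1m -ip comp_suml comp_sumr; apply: eq_bigr => m _.
by rewrite IS PS !compA.
Qed.

(** * Local endomorphism rings *)

Lemma is_iso_idm X : is_iso (idm X).
Proof. by exists (idm X); rewrite comp1m. Qed.

Lemma is_iso0 X : idm X != 0 -> ~ is_iso (0 : hom X X).
Proof. by move=> X0 [g [g0 _]]; case/eqP: X0; rewrite -g0 comp0r. Qed.

Lemma local_sum X n (f : 'I_n -> hom X X) :
  local_end X -> is_iso (\sum_(k < n) f k) -> exists k, is_iso (f k).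
Proof.
move=> [X0 locX]; elim: n f => [|n IH] f.
  by rewrite big_ord0 => /(is_iso0 X0).
rewrite big_ord_recl => iso_f; apply: contrapT => nf.
apply: locX iso_f => [iso_f|/IH[k iso_f]]; apply: nf.
  by exists ord0.
by exists (lift ord0 k).
Qed.

Lemma idem_iso X (e : hom X X) : e \oc e = e -> is_iso e -> e = idm X.
Proof.
by move=> ee [g [ge _]]; rewrite -(comp1m e) -{1}ge -compA ee.
Qed.

(** Of e and 1 - e one is invertible, and an invertible idempotent is 1. *)
Lemma local_idem X (e : hom X X) :
  local_end X -> e \oc e = e -> e = 0 \/ e = idm X.
Proof.
move=> [X0 locX] ee; pose e' := idm X - e.
have [/(idem_iso ee) ->|ne] := pselect (is_iso e); first by right.
left; have [[g [_ e'g]]|ne'] := pselect (is_iso e').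
  rewrite -[e]compm1 -e'g compA.
  by rewrite compDr compm1 compNr ee subrr comp0l.
by case: (locX _ _ ne ne'); rewrite /e' addrC subrK; exact: is_iso_idm.
Qed.

(** The idempotent of Y that a nonzero retract defines is not 0, hence is 1. *)
Lemma iso_of_retract X Y : idm X != 0 -> local_end Y -> retract X Y -> iso X Y.
Proof.
move=> X0 locY [i [p pi]].
have ee : (i \oc p) \oc (i \oc p) = i \oc p.
  by rewrite compA -(compA i p) pi compm1.
case: (local_idem locY ee) => ip; last by exists i, p.
by case/eqP: X0; rewrite -pi -[i]compm1 -pi (compA i) ip comp0l comp0r.
Qed.

(** The identity of X becomes a sum of endomorphisms that factor through the
    Z k, and in a local ring one of these is invertible. *)
Lemma local_retract_sum X Y n (Z : 'I_n -> C)
    (i : forall k, hom (Z k) Y) (p : forall k, hom Y (Z k)) :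
  local_end X -> \sum_(k < n) (i k \oc p k) = idm Y -> retract X Y ->
  exists k, retract X (Z k).
Proof.
move=> locX ip [j [q qj]].
have /(local_sum locX)[k [g [gk _]]] :
    is_iso (\sum_(k < n) (q \oc (i k \oc p k) \oc j)).
  rewrite -comp_suml -comp_sumr ip compm1 qj; exact: is_iso_idm.
by exists k, (p k \oc j), (g \oc q \oc i k); rewrite -gk !compA.
Qed.

Lemma local_retract_dsum X Y Z W :
  local_end X -> is_dsum Y Z W -> retract X W -> retract X Y \/ retract X Z.
Proof.
move=> [X0 locX] [i1 [i2 [p1 [p2 [_ _ _ _ ip]]]]] [j [q qj]].
apply: contrapT => nXYZ.
apply: (locX (q \oc (i1 \oc p1) \oc j) (q \oc (i2 \oc p2) \oc j)).
- move=> [g [gk _]]; apply: nXYZ; left.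
  by exists (p1 \oc j), (g \oc q \oc i1); rewrite -gk !compA.
- move=> [g [gk _]]; apply: nXYZ; right.
  by exists (p2 \oc j), (g \oc q \oc i2); rewrite -gk !compA.
rewrite -compDl -compDr ip compm1 qj; exact: is_iso_idm.
Qed.

(** * Krull-Schmidt categories *)

Hypothesis KS : krull_schmidt C.

Lemma rep_local (x : inde C) : local_end (rep x).
Proof. by case: KS => _ _; apply; exact: rep_indecomposable. Qed.

Lemma rep_neq0 (x : inde C) : idm (rep x) != 0.
Proof. by have [] := rep_local x. Qed.

Lemma inde_retract_eq (x y : inde C) : retract (rep x) (rep y) -> x = y.
Proof.
by move=> xy; apply/inde_eqP; apply: iso_of_retract xy;
  [exact: rep_neq0 | exact: rep_local].
Qed.

Lemma rep_decomposition Z :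
  exists n (x : 'I_n -> inde C), is_big_dsum (fun k => rep (x k)) Z.
Proof.
have [_ /(_ Z)[n [X [indX [i [p [pi pi0 ip]]]]]] _] := KS.
have [x xX] := choice (fun k => inde_surj (indX k)).
pose f k : hom (rep (x k)) (X k) := sval (cid (xX k)).
pose g k : hom (X k) (rep (x k)) := sval (cid (svalP (cid (xX k)))).
have gP k : g k \oc f k = idm _ /\ f k \oc g k = idm _.
  exact: svalP (cid (svalP (cid (xX k)))).
exists n, x, (fun k => i k \oc f k), (fun k => g k \oc p k); split.
- move=> k; rewrite compA -(compA _ (p k)) pi compm1.
  by case: (gP k).
- by move=> j k jk; rewrite compA -(compA _ (p j)) pi0 // comp0r comp0l.
rewrite -[RHS]ip; apply: eq_bigr => k _.
by rewrite compA -(compA _ (f k)) (gP k).2 compm1.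
Qed.

Lemma big_dsum_summand n (X : 'I_n -> C) k Z :
  is_big_dsum X Z -> summand (X k) Z.
Proof.
case: n X k => [|n] X k XZ; first by case: k.
have [addC _ _] := KS.
have [W XW] := big_dsum_exists (fun m => X (lift k m)) addC.
by exists W; exact: big_dsumD1.
Qed.

(** A complement exists because the retract is isomorphic to a term of a
    decomposition of Z. *)
Lemma retract_summand (x : inde C) Z : retract (rep x) Z -> summand (rep x) Z.
Proof.
move=> xZ; have [n [y yZ]] := rep_decomposition Z.
have [i [p [_ _ ip]]] := yZ.
have [k /inde_retract_eq ->] := local_retract_sum (rep_local x) ip xZ.
exact: big_dsum_summand yZ.
Qed.

End Preadditive.

(** * Coherence of the unit constraints *)

Section Coherence.
Variable C : monoidalCat.
Implicit Types X Y Z W : C.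

(** The form in which an equation between composites is used inside a
    composite associated to the left. *)
Lemma comp_eql (D : preaddCat) (W X Y Z : D) (g : hom X Y) (f : hom W X)
    (h : hom W Y) (gf : g \oc f = h) (k : hom Y Z) :
  k \oc g \oc f = k \oc h.
Proof. by rewrite -compA gf. Qed.

Lemma comp_idl (D : preaddCat) (X Y Z : D) (g : hom X Y) (f : hom Y X)
    (gf : g \oc f = idm Y) (k : hom Y Z) :
  k \oc g \oc f = k.
Proof. by rewrite -compA gf compm1. Qed.

Lemma tens1_comp X Y Z W (g : hom Y Z) (f : hom X Y) :
  idm W \oxm (g \oc f) = (idm W \oxm g) \oc (idm W \oxm f).
Proof. by rewrite -tensm_comp comp1m. Qed.

Lemma tens_comp1 X Y Z W (g : hom Y Z) (f : hom X Y) :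
  (g \oc f) \oxm idm W = (g \oxm idm W) \oc (f \oxm idm W).
Proof. by rewrite -tensm_comp comp1m. Qed.

Lemma tens_swap X X' Y Y' (f : hom X X') (g : hom Y Y') :
  (idm X' \oxm g) \oc (f \oxm idm Y) = (f \oxm idm Y') \oc (idm X \oxm g).
Proof. by rewrite -!tensm_comp !comp1m !compm1. Qed.

Lemma tensm0l X X' Y Y' (g : hom Y Y') : (0 : hom X X') \oxm g = 0.
Proof. by apply: (addIr (0 \oxm g)); rewrite -tensmDl !add0r. Qed.

Lemma tensm0r X X' Y Y' (f : hom X X') : f \oxm (0 : hom Y Y') = 0.
Proof. by apply: (addIr (f \oxm 0)); rewrite -tensmDr !add0r. Qed.

Lemma tensm_suml X X' Y Y' n (f : 'I_n -> hom X X') (g : hom Y Y') :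
  (\sum_(k < n) f k) \oxm g = \sum_(k < n) (f k \oxm g).
Proof.
elim: n f => [|n IH] f; first by rewrite !big_ord0 tensm0l.
by rewrite !big_ord_recl tensmDl IH.
Qed.

Lemma tensm_sumr X X' Y Y' n (f : hom X X') (g : 'I_n -> hom Y Y') :
  f \oxm (\sum_(k < n) g k) = \sum_(k < n) (f \oxm g k).
Proof.
elim: n g => [|n IH] g; first by rewrite !big_ord0 tensm0r.
by rewrite !big_ord_recl tensmDr IH.
Qed.

Lemma assocV_nat X X' Y Y' Z Z' (f : hom X X') (g : hom Y Y') (h : hom Z Z') :
  assocV X' Y' Z' \oc (f \oxm (g \oxm h)) = ((f \oxm g) \oxm h) \oc assocV X Y Z.
Proof.
rewrite -[LHS]compm1 -assocVK !compA.
by rewrite (comp_eql (esym (assoc_nat f g h))) !compA assocK comp1m.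
Qed.

Lemma lunitV_nat X Y (f : hom X Y) :
  lunitV Y \oc f = (idm unit_ob \oxm f) \oc lunitV X.
Proof.
rewrite -[LHS]compm1 -lunitVK !compA.
by rewrite (comp_eql (esym (lunit_nat f))) !compA lunitK comp1m.
Qed.

Lemma runitV_nat X Y (f : hom X Y) :
  runitV Y \oc f = (f \oxm idm unit_ob) \oc runitV X.
Proof.
rewrite -[LHS]compm1 -runitVK !compA.
by rewrite (comp_eql (esym (runit_nat f))) !compA runitK comp1m.
Qed.

Lemma tens_unitr_inj X Y (f g : hom X Y) :
  f \oxm idm unit_ob = g \oxm idm (unit_ob : C) -> f = g.
Proof.
move=> fg; rewrite -[f]compm1 -[g]compm1 -runitVK !compA.
by rewrite -!runit_nat fg.
Qed.

Lemma tens_unitl_inj X Y (f g : hom X Y) :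
  idm (unit_ob : C) \oxm f = idm unit_ob \oxm g -> f = g.
Proof.
move=> fg; rewrite -[f]compm1 -[g]compm1 -lunitVK !compA.
by rewrite -!lunit_nat fg.
Qed.

(** Kelly's argument: tensoring with the unit is faithful, and after it both sides
    are compared by one pentagon and two triangles.  [lunit_tens] is similar. *)
Lemma runit_tens X Y :
  runit (X \ox Y) = (idm X \oxm runit Y) \oc assoc X Y unit_ob.
Proof.
apply: tens_unitr_inj.
rewrite -[LHS]comp1m -[RHS]comp1m -assocK -!(compA (assocV _ _ _)).
congr (_ \oc _).
rewrite -triangle tens_comp1 !compA assoc_nat -tensm1 assoc_nat.
rewrite -triangle tens1_comp.
by rewrite (comp_eql (pentagon _ _ _ _)) !compA.
Qed.

Lemma lunit_tens X Y :
  lunit (X \ox Y) \oc assoc unit_ob X Y = lunit X \oxm idm Y.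
Proof.
apply: tens_unitl_inj.
have aV : assoc unit_ob (unit_ob \ox X) Y \oc
    (assoc unit_ob unit_ob X \oxm idm Y) \oc
    ((assocV unit_ob unit_ob X \oxm idm Y) \oc assocV unit_ob (unit_ob \ox X) Y)
    = idm _.
  by rewrite !compA (comp_eql (esym (tens_comp1 _ _ _))) assocVK tensm1 compm1 assocVK.
rewrite -[LHS]compm1 -[RHS]compm1 -aV 2![in RHS]compA 2![in LHS]compA.
congr (_ \oc _).
rewrite tens1_comp !compA -2!(compA (idm unit_ob \oxm lunit (X \ox Y))).
rewrite -pentagon compA triangle -tensm1 -!assoc_nat.
by rewrite -(triangle unit_ob X) tens_comp1 !compA.
Qed.

Lemma lunit_unit : lunit unit_ob = runit (unit_ob : C).
Proof.
apply: tens_unitl_inj.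
have ru : runit unit_ob \oxm idm unit_ob = runit (unit_ob \ox (unit_ob : C)).
  rewrite -[LHS]comp1m -[RHS]comp1m -runitK -!(compA (runitV _)).
  by rewrite runit_nat.
have := triangle (unit_ob : C) unit_ob; rewrite ru runit_tens => e.
rewrite -[LHS]compm1 -[RHS]compm1 -assocVK !compA.
by rewrite e.
Qed.

Lemma lunitV_unit : lunitV unit_ob = runitV (unit_ob : C).
Proof.
by rewrite -[LHS]compm1 -runitVK compA -lunit_unit lunitK comp1m.
Qed.

Lemma tens_runitV X Y :
  idm X \oxm runitV Y = assoc X Y unit_ob \oc runitV (X \ox Y).
Proof.
rewrite -[RHS]comp1m -tensm1 -(runitK Y) tens1_comp.
by rewrite !compA (comp_eql (esym (runit_tens _ _))) (comp_idl (runitVK _)).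
Qed.

(** * Duality *)

Section Duality.
Variables (X : C) (DX : right_dual X).
Local Notation V := (dual DX).

(** The adjunction isomorphism from C(X,Y) to C(1, X^v (x) Y).  Like its inverse, it
    is built from composition and tensoring on the left alone, so both preserve
    every left-tensor ideal. *)
Definition transpose Y (f : hom X Y) : hom unit_ob (V \ox Y) :=
  (idm V \oxm f) \oc co DX.

Definition untranspose Y (g : hom unit_ob (V \ox Y)) : hom X Y :=
  lunit Y \oc (ev DX \oxm idm Y) \oc assocV X V Y \oc (idm X \oxm g) \oc runitV X.

Lemma transposeK Y (f : hom X Y) : untranspose (transpose f) = f.
Proof.
rewrite /untranspose /transpose tens1_comp !compA.
rewrite (comp_eql (assocV_nat _ _ _)) !compA tensm1.
rewrite (comp_eql (esym (tens_swap _ _))) !compA lunit_nat.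
rewrite -2!(compA (f \oc lunit X)) (zigzag_l DX).
by rewrite !compA (comp_idl (lunitVK _)) (comp_idl (runitVK _)).
Qed.

(** Move g to the right, past the coevaluation; what is left on its left is the
    second zigzag for X^v, tensored with Y. *)
Lemma untransposeK Y (g : hom unit_ob (V \ox Y)) :
  transpose (untranspose g) = g.
Proof.
rewrite /untranspose /transpose !tens1_comp.
rewrite tens_runitV !compA (comp_eql (esym (assoc_nat _ _ _))) !compA.
rewrite (comp_eql (runitV_nat _)) !compA tensm1.
rewrite (comp_eql (tens_swap _ _)) !compA.
rewrite -lunitV_unit (comp_eql (esym (lunitV_nat _))) !compA.
rewrite -[RHS]comp1m; congr (_ \oc _).
have pent : (idm V \oxm assocV X V Y) \oc assoc V X (V \ox Y) =
    assoc V (X \ox V) Y \oc (assoc V X V \oxm idm Y) \oc assocV (V \ox X) V Y.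
  rewrite -[LHS]compm1 -assocVK !compA (comp_eql (pentagon _ _ _ _)) !compA.
  by rewrite -tens1_comp assocK tensm1 comp1m.
rewrite (comp_eql pent) !compA.
rewrite -(tensm1 V Y) (comp_eql (assocV_nat _ _ _)) !compA.
rewrite (comp_eql (esym (assoc_nat _ _ _))) !compA.
rewrite triangle.
rewrite -!tens_comp1 -!(compA (runit V)) (zigzag_r DX) compA runitVK comp1m.
by rewrite tensm1 -lunit_tens (comp_idl (assocVK _ _ _)) lunitVK.
Qed.

Lemma tid_transpose (J : TId C) Y (f : hom X Y) : J X Y f <-> J _ _ (transpose f).
Proof.
split=> Jf; first by apply/tid_compr/tid_tens.
rewrite -(transposeK f); apply: tid_compr.
by rewrite -!compA; do 3!apply: tid_compl; apply: tid_tens.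
Qed.

End Duality.

(** * Ideals from objects and from morphisms *)

Lemma TId_eqP (J J' : TId C) :
  le_TId J J' -> le_TId J' J -> J = J'.
Proof.
move=> le1 le2.
have e : tid J = tid J'.
  apply: functional_extensionality_dep => X.
  apply: functional_extensionality_dep => Y.
  by apply/seteqP; split=> f; [exact: le1 | exact: le2].
case: J J' e {le1 le2} => [J a1 a2 a3 a4 a5] [J' b1 b2 b3 b4 b5] /= e.
rewrite -{}e in b1 b2 b3 b4 b5 *.
by congr LeftTensorIdeal; exact: Prop_irrelevance.
Qed.

Lemma Id_eqP (I I' : Id C) : le_Id I I' -> le_Id I' I -> I = I'.
Proof.
move=> le1 le2.
have e : thick I = thick I'.
  apply: functional_extensionality_dep => X; apply: propext.
  by split; [exact: le1 | exact: le2].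
case: I I' e {le1 le2} => [I a1 a2 a3 a4] [I' b1 b2 b3 b4] /= e.
rewrite -{}e in b1 b2 b3 b4 *.
by congr ThickIdeal; exact: Prop_irrelevance.
Qed.

Section FactorIdeal.
Hypothesis addC : additive_cat C.
Variable I : Id C.

Let fac : forall X Y, set (hom X Y) := fun X Y =>
  [set f | exists Z (a : hom Z Y) (b : hom X Z), thick I Z /\ f = a \oc b].

Fact fac0 X Y : fac (0 : hom X Y).
Proof.
have [[O O0] _] := addC.
exists O, 0, 0; split; first exact: thick0.
by rewrite comp0l.
Qed.

Fact facB X Y (f g : hom X Y) : fac f -> fac g -> fac (f - g).
Proof.
move=> [Z [a [b [IZ ->]]]] [W [c [d [IW ->]]]].
have [_ /(_ Z W)[U ZWU]] := addC.
have IU : I U by apply/(thick_dsum I ZWU).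
have [i1 [i2 [p1 [p2 [pi1 pi2 pi12 pi21 ip]]]]] := ZWU.
exists U, (a \oc p1 - c \oc p2), (i1 \oc b + i2 \oc d); split=> //.
rewrite compDr !compDl !compNl !compA.
rewrite (comp_idl pi1) (comp_idl pi2) (comp_eql pi12) (comp_eql pi21).
by rewrite !comp0r !comp0l subr0 add0r.
Qed.

Fact fac_compl X Y Z (g : hom Y Z) (f : hom X Y) : fac f -> fac (g \oc f).
Proof. by move=> [W [a [b [IW ->]]]]; exists W, (g \oc a), b; rewrite compA. Qed.

Fact fac_compr X Y Z (g : hom Y Z) (f : hom X Y) : fac g -> fac (g \oc f).
Proof. by move=> [W [a [b [IW ->]]]]; exists W, a, (b \oc f); rewrite compA. Qed.

Fact fac_tens X Y Z (f : hom X Y) : fac f -> fac (idm Z \oxm f).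
Proof.
move=> [W [a [b [IW ->]]]]; exists (Z \ox W), (idm Z \oxm a), (idm Z \oxm b).
by split; [exact: thick_tens | rewrite tens1_comp].
Qed.

Definition factor_ideal : TId C :=
  LeftTensorIdeal fac0 facB fac_compl fac_compr fac_tens.

End FactorIdeal.

Section PrincipalIdeal.
Variables (A : C) (g : hom unit_ob A).

Let pri : forall X Y, set (hom X Y) := fun X Y =>
  [set f | exists h : hom (X \ox A) Y, f = h \oc (idm X \oxm g) \oc runitV X].

Fact pri0 X Y : pri (0 : hom X Y).
Proof. by exists 0; rewrite !comp0l. Qed.

Fact priB X Y (f f' : hom X Y) : pri f -> pri f' -> pri (f - f').
Proof.
by move=> [h ->] [h' ->]; exists (h - h'); rewrite !compDl !compNl.
Qed.

Fact pri_compl X Y Z (k : hom Y Z) (f : hom X Y) : pri f -> pri (k \oc f).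
Proof. by move=> [h ->]; exists (k \oc h); rewrite !compA. Qed.

Fact pri_compr X Y Z (k : hom Y Z) (f : hom X Y) : pri k -> pri (k \oc f).
Proof.
move=> [h ->]; exists (h \oc (f \oxm idm A)).
by rewrite (comp_eql (runitV_nat f)) !compA (comp_eql (tens_swap f g)) !compA.
Qed.

Fact pri_tens X Y Z (f : hom X Y) : pri f -> pri (idm Z \oxm f).
Proof.
move=> [h ->]; exists ((idm Z \oxm h) \oc assoc Z X A).
rewrite !tens1_comp tens_runitV !compA.
by rewrite (comp_eql (esym (assoc_nat _ _ _))) tensm1 !compA.
Qed.

(** The left-tensor ideal generated by g, in a form that makes it closed under
    sums and explicit on C(1,-), where it has only the composites h g
    ([principal_unitP]). *)
Definition principal_ideal : TId C :=
  LeftTensorIdeal pri0 priB pri_compl pri_compr pri_tens.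

Lemma principal_unitP Y (f : hom unit_ob Y) :
  principal_ideal _ _ f <-> exists h : hom A Y, f = h \oc g.
Proof.
split=> [[h ->]|[h ->]].
  exists (h \oc lunitV A).
  by rewrite -lunitV_unit (comp_eql (esym (lunitV_nat g))) !compA.
exists (h \oc lunit A).
by rewrite -lunitV_unit (comp_eql (lunit_nat g)) !compA (comp_idl (lunitVK _)).
Qed.

Lemma principal_gen : principal_ideal _ _ g.
Proof. by apply/principal_unitP; exists (idm A); rewrite comp1m. Qed.

End PrincipalIdeal.

End Coherence.

(** * Krull-Schmidt monoidal categories *)

Section KrullSchmidtMonoidal.
Variable C : monoidalCat.
Implicit Types X Y Z W : C.
Hypothesis KS : krull_schmidt C.

Lemma retract_tens X X' Y Y' :
  retract X X' -> retract Y Y' -> retract (X \ox Y) (X' \ox Y').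
Proof.
move=> [i [p pi]] [j [q qj]]; exists (i \oxm j), (p \oxm q).
by rewrite -tensm_comp pi qj tensm1.
Qed.

(** Expand the identities of X and Y along their decompositions, one factor at a
    time. *)
Lemma local_retract_tens Z X Y :
  local_end Z -> retract Z (X \ox Y) ->
  exists x y : inde C, [/\ retract (rep x) X, retract (rep y) Y
    & retract Z (rep x \ox rep y)].
Proof.
move=> locZ ZXY.
have [n [x xX]] := rep_decomposition KS X.
have [m [y yY]] := rep_decomposition KS Y.
have [i [p [_ _ ip]]] := xX; have [j [q [_ _ jq]]] := yY.
have ip1 : \sum_(k < n) ((i k \oxm idm Y) \oc (p k \oxm idm Y)) = idm _.
  under eq_bigr => k _ do rewrite -tens_comp1.
  by rewrite -tensm_suml ip tensm1.
have [k Zk] := local_retract_sum locZ ip1 ZXY.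
have jq1 : \sum_(h < m) ((idm (rep (x k)) \oxm j h) \oc (idm _ \oxm q h)) = idm _.
  under eq_bigr => h _ do rewrite -tens1_comp.
  by rewrite -tensm_sumr jq tensm1.
have [h Zh] := local_retract_sum locZ jq1 Zk.
exists (x k), (y h); split=> //; apply: summand_retract.
  exact: big_dsum_summand KS _ _ _ _ xX.
exact: big_dsum_summand KS _ _ _ _ yY.
Qed.

Lemma assoc_iso X Y Z : iso (X \ox Y \ox Z) (X \ox (Y \ox Z)).
Proof.
by exists (assoc X Y Z), (assocV X Y Z); rewrite assocK assocVK.
Qed.

Lemma lunit_iso X : iso (unit_ob \ox X) X.
Proof. by exists (lunit X), (lunitV X); rewrite lunitK lunitVK. Qed.

Lemma thick_big_dsum (I : Id C) n (X : 'I_n -> C) Z :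
  is_big_dsum X Z -> (forall k, I (X k)) -> I Z.
Proof.
elim: n X Z => [|n IH] X Z XZ IX.
  by case: XZ => i [p [_ _]]; rewrite big_ord0 => Z0; apply: thick0.
have [addC _ _] := KS.
have [W XW] := big_dsum_exists (fun m => X (lift ord0 m)) addC.
by apply/(thick_dsum I (big_dsumD1 XZ XW)); split=> //; exact: IH XW _.
Qed.

(** Each indecomposable summand of X is a retract of Z, hence a direct summand. *)
Lemma thick_retract (I : Id C) X Z : retract X Z -> I Z -> I X.
Proof.
move=> XZ IZ; have [n [x xX]] := rep_decomposition KS X.
apply: (thick_big_dsum xX) => k.
have xkX := summand_retract (big_dsum_summand KS k xX).
have [W xkW] := retract_summand KS (retract_trans xkX XZ).
by have [] := (thick_dsum I xkW).1 IZ.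
Qed.

(** An object whose identity factors through an object of I is a retract of it,
    and thick ideals are closed under retracts.  Hence Ob is surjective. *)
Lemma Ob_factor_ideal (addC : additive_cat C) (I : Id C) :
  Ob (factor_ideal addC I) = I.
Proof.
apply: Id_eqP => X; last by move=> IX; exists X, (idm X), (idm X); rewrite comp1m.
by move=> [Z [a [b [IZ ab]]]]; apply: thick_retract IZ; exists b, a.
Qed.

(** Transposing a morphism to C(1,-) and decomposing its target shows that a
    left-tensor ideal is governed by the morphisms from the unit to the
    indecomposables. *)
Lemma le_TId_unit (D : right_rigid C) (J J' : TId C) :
  (forall (x : inde C) (f : hom unit_ob (rep x)), J _ _ f -> J' _ _ f) ->
  le_TId J J'.
Proof.
move=> JJ' X Y f /(tid_transpose (D X)) Jf; apply/(tid_transpose (D X)).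
move: (transpose _ _) Jf => g Jg.
have [n [x [i [p [_ _ ip]]]]] := rep_decomposition KS (dual (D X) \ox Y).
rewrite -[g]comp1m -ip comp_suml.
apply: big_ind => [|u v J'u J'v|k _]; first exact: tid0.
- rewrite -[v]opprK; apply: tidB => //; rewrite -[- v]add0r.
  by apply: tidB => //; exact: tid0.
by rewrite -compA; apply/tid_compl/JJ'/tid_compl.
Qed.

(** The coevaluation of X lies in J and is nonzero, hence has a nonzero
    component in some indecomposable summand of X^v (x) X. *)
Lemma nonzero_unit_map (D : right_rigid C) (J : TId C) X :
  Ob J X -> ~ is_zero X ->
  exists (x : inde C) (f : hom unit_ob (rep x)),
    [/\ f != 0, J _ _ f & retract (rep x) (dual (D X) \ox X)].
Proof.
move=> JX X0; have Jco := (tid_transpose (D X) J (idm X)).1 JX.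
have co0 : transpose (D X) (idm X) <> 0.
  move=> e; apply: X0; rewrite /is_zero -(transposeK (D X) (idm X)) e.
  by rewrite /untranspose tensm0r comp0r comp0l.
have [n [x xX]] := rep_decomposition KS (dual (D X) \ox X).
have [i [p [_ _ ip]]] := xX.
have [k pk] : exists k, p k \oc transpose (D X) (idm X) != 0.
  apply: contrapT => np; apply: co0.
  rewrite -[LHS]comp1m -ip comp_suml big1 // => k _.
  rewrite -compA; have [->|pk] := eqVneq (p k \oc transpose (D X) (idm X)) 0.
    by rewrite comp0r.
  by case: np; exists k.
exists (x k), (p k \oc transpose (D X) (idm X)); split=> //.
  exact: tid_compl.
exact: summand_retract (big_dsum_summand KS k xX).
Qed.

End KrullSchmidtMonoidal.

(** * Objects with scalar endomorphisms *)

Section Scalar.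
Variable C : monoidalCat.
Implicit Types X Y Z : C.

Lemma scal_unit Y (f : hom unit_ob Y) a : scal f a = f \oc a.
Proof.
rewrite /scal -[f in LHS]compm1 -[a in LHS]comp1m tensm_comp !compA runit_nat.
rewrite -lunitV_unit -lunit_unit (comp_eql (lunit_nat a)) !compA.
exact: comp_idl (lunitVK _) _.
Qed.

Lemma transpose_scal X (DX : right_dual X) a :
  transpose DX (scal (idm X) a) = co DX \oc a.
Proof.
rewrite -scal_unit /transpose /scal !tens1_comp tens_runitV !compA.
rewrite (comp_eql (esym (assoc_nat _ _ _))) !compA -runit_tens tensm1.
rewrite (comp_eql (runitV_nat _)) !compA; congr (_ \oc _).
by rewrite -!compA -tensm_comp comp1m compm1.
Qed.

(** By duality such a map is the transpose of an endomorphism of X, that is, of a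
    scalar. *)
Lemma scalar_end_co X (DX : right_dual X) (h : hom unit_ob (dual DX \ox X)) :
  scalar_end X -> exists a, h = co DX \oc a.
Proof.
move=> [s _ sK]; exists (s (untranspose h)).
by rewrite -transpose_scal sK untransposeK.
Qed.

Lemma unit_invertible (a : hom (unit_ob : C) unit_ob) :
  unit_field C -> a != 0 -> exists b, a \oc b = idm unit_ob.
Proof. by move=> [_ _ inv] /inv[b [_ ab]]; exists b. Qed.

Section ScalarEnd.
Variables (X A : C) (DX : right_dual X) (g : hom unit_ob A).
Hypotheses (kC : unit_field C) (XX : scalar_end X).
Hypotheses (AX : retract A (dual DX \ox X)) (g0 : g != 0).

(** Maps from the unit to A are multiples of the coevaluation composed with the
    projection to A; as g is nonzero, its own multiple is invertible. *)
Lemma unit_map_multiple (f : hom unit_ob A) : exists a, f = g \oc a.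
Proof.
have [i [p pi]] := AX.
have [a ia] := scalar_end_co (i \oc g) XX.
have [b ib] := scalar_end_co (i \oc f) XX.
have ga : g = p \oc co DX \oc a by rewrite -compA -ia compA pi comp1m.
have fb : f = p \oc co DX \oc b by rewrite -compA -ib compA pi comp1m.
have a0 : a != 0 by apply: contraNneq g0 => a0; rewrite ga a0 comp0r.
have [c ac] := unit_invertible kC a0.
by exists (c \oc b); rewrite ga fb !compA (comp_idl ac).
Qed.

(** The coevaluation factors through g and g through the coevaluation, so an
    ideal contains both or neither. *)
Lemma Ob_unit_map (J : TId C) : Ob J X <-> J _ _ g.
Proof.
have [i [p pi]] := AX.
have [a ia] := scalar_end_co (i \oc g) XX.
have ga : g = p \oc co DX \oc a by rewrite -compA -ia compA pi comp1m.
have a0 : a != 0 by apply: contraNneq g0 => a0; rewrite ga a0 comp0r.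
have [c ac] := unit_invertible kC a0.
have tr1 : transpose DX (idm X) = co DX by rewrite /transpose tensm1 comp1m.
split=> [/(tid_transpose DX)|Jg].
  by rewrite tr1 ga => Jco; apply/tid_compr/tid_compl.
apply/(tid_transpose DX); rewrite tr1 -[co DX](comp_idl ac) -ia.
by apply/tid_compr/tid_compl.
Qed.

End ScalarEnd.

Lemma unit_local : unit_field C -> local_end (unit_ob : C).
Proof.
move=> [u0 _ inv]; split=> // f g nf ng fg.
have [f0|/inv//] := eqVneq f 0; have [g0|/inv//] := eqVneq g 0.
by apply: (is_iso0 u0); rewrite -[0](addr0 0) -{1}f0 -g0.
Qed.

End Scalar.

(** * The order on the indecomposables of a controlled category *)

Section Controlled.
Variables (S : monoidalCat) (ell : inde S -> nat).
Hypothesis hS : l_controlled ell.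

Let KS : krull_schmidt S. Proof. by case: hS. Qed.

Lemma ell_summand k l m :
  summand (rep k) (rep m \ox rep l) -> ell k = (ell m + ell l)%N.
Proof. by case: hS => _ _ _; apply. Qed.

(** If m in the definition of l below n has length 0, it is the unit and then n = l;
    otherwise it makes n strictly longer. *)
Lemma prec_eq_or_lt (l n : inde S) : prec l n -> l = n \/ (ell l < ell n)%N.
Proof.
move=> [m lmn]; have := ell_summand lmn; case: (posnP (ell m)) => [m0 _|m0 ->].
  left; apply/esym/(inde_retract_eq KS).
  apply: retract_trans (iso_retract (lunit_iso _)).
  apply: retract_trans (summand_retract lmn) _.
  apply: retract_tens; last exact/iso_retract/iso_refl.
  by apply/iso_retract; case: hS => _ _ /(_ m)[/(_ m0)].
by right; rewrite -{1}[ell l]add0n ltn_add2r.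
Qed.

Lemma prec_ell (l n : inde S) : prec l n -> (ell l <= ell n)%N.
Proof. by move=> /prec_eq_or_lt[->//|/ltnW]. Qed.

Lemma prec_refl (u l : inde S) : iso (rep u) unit_ob -> prec l l.
Proof.
move=> u1; exists u; apply: retract_summand => //.
apply: retract_trans (iso_retract (iso_sym (lunit_iso _))) _.
apply: retract_tens; last exact/iso_retract/iso_refl.
exact/iso_retract/iso_sym.
Qed.

Lemma prec_trans (k l n : inde S) : prec k l -> prec l n -> prec k n.
Proof.
move=> [m lmk] [m' nml].
have : retract (rep n) (rep m' \ox rep m \ox rep k).
  apply: retract_trans (iso_retract (iso_sym (assoc_iso _ _ _))).
  apply: retract_trans (summand_retract nml) _.
  apply: retract_tens; first exact/iso_retract/iso_refl.
  exact: summand_retract.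
move=> /(local_retract_tens KS (rep_local KS n))[x [y [_ yk nxy]]].
exists x; apply: retract_summand => //.
by rewrite -(inde_retract_eq KS yk).
Qed.

End Controlled.

(** * Transport along the functor *)

Section Transport.
Variables (S C : monoidalCat) (T : monoidalFunctor S C).

Lemma fmap_dsum_id n (X : 'I_n -> S) Z (i : forall k, hom (X k) Z)
    (p : forall k, hom Z (X k)) :
  \sum_(k < n) (i k \oc p k) = idm Z ->
  \sum_(k < n) (fmap T (i k) \oc fmap T (p k)) = idm (T Z).
Proof.
move=> ip; under eq_bigr => k _ do rewrite -fmap_comp.
rewrite -fmap1 -ip; apply: (big_ind2 (fun x y => x = fmap T y)) => //.
  by apply: (addIr (fmap T (0 : hom Z Z))); rewrite -fmapD !add0r.
by move=> x1 x2 y1 y2 -> ->; rewrite fmapD.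
Qed.

Lemma fmap_retract X Y : retract X Y -> retract (T X) (T Y).
Proof.
by move=> [i [p pi]]; exists (fmap T i), (fmap T p); rewrite -fmap_comp pi fmap1.
Qed.

Lemma ftens_isoT X Y : iso (T X \ox T Y) (T (X \ox Y)).
Proof. by exists (ftens T X Y); exact: ftens_iso. Qed.

End Transport.

Section Classification.
Variables (S C : monoidalCat) (ell : inde S -> nat) (T : monoidalFunctor S C).
Variables (D : right_rigid C) (R : inde S -> inde C) (phi : inde S -> inde S).
Variable nu : nat -> inde S.
Local Notation L := (label_set (with_invariants C)).
Local Notation Lambda_ j := (dual_summand_set phi (nu j)).

Hypotheses (hS : l_controlled ell) (hC : krull_schmidt C) (hk : unit_field C).
Hypothesis (ha : bijective R /\
    forall l : inde S, exists X : C,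
      is_dsum (rep (R l)) X (T (rep l)) /\
      forall m : inde S, summand (rep (R m)) X -> sprec m l).
Hypothesis (hphi : forall l : inde S,
  iso (dual (D (rep (R l)))) (rep (R (phi l)))).
Hypothesis (hnuB : with_invariants C = [set R (nu j) | j in L]).
Hypothesis (hnu0 : ell (nu 0%N) = 0%N).
Hypothesis (hnu : forall j j' : nat, L j -> L j' -> (j < j')%N ->
    (ell (nu j) < ell (nu j'))%N).
Hypothesis (hd : forall j : nat, L j ->
    Lambda_ j !=set0 /\
    forall l : inde S, Lambda_ j l -> scalar_end (rep (R l))).
Hypothesis (he : forall j j' : nat, L j -> L j' -> (j < j')%N ->
    forall l' : inde S, Lambda_ j' l' ->
    exists l : inde S, Lambda_ j l /\ sprec l l').
Hypothesis (hf : forall (l : inde S) (j : nat), L j ->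
    (exists k : inde S, prec (nu j) k /\
       summand (rep k) (rep (phi l) \ox rep l)) ->
    exists m : inde S, Lambda_ j m /\ prec m l).

Let KS : krull_schmidt S. Proof. by case: hS. Qed.

Let nu0_unit : iso (rep (nu 0%N)) unit_ob.
Proof. by case: hS => _ _ /(_ (nu 0%N))[/(_ hnu0)]. Qed.

Let R_inj : injective R. Proof. by case: ha => /bij_inj. Qed.

Let R_surj x : exists l, x = R l.
Proof. by case: ha => [[R' _ RK] _]; exists (R' x); rewrite RK. Qed.

Lemma R_retract_T l : retract (rep (R l)) (T (rep l)).
Proof. by have [X [/dsum_retractl]] := ha.2 l. Qed.

Lemma prec_of_retract_T m l : retract (rep (R m)) (T (rep l)) -> prec m l.
Proof.
have [X [TX mX]] := ha.2 l.
move=> /(local_retract_dsum (rep_local hC _) TX)[/(inde_retract_eq hC)/R_inj->|].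
  exact: prec_refl hS _ _ nu0_unit.
by move=> /(retract_summand hC)/mX[].
Qed.

(** Such an R(n) occurs in T(m (x) l), which is the sum of the T(k) over the summands k
    of m (x) l. *)
Lemma prec_of_retract_tens n m l :
  retract (rep (R n)) (rep (R m) \ox rep (R l)) ->
  exists2 k, summand (rep k) (rep m \ox rep l) & prec n k.
Proof.
move=> nml; have [h [x xml]] := rep_decomposition KS (rep m \ox rep l).
have [i [p [_ _ ip]]] := xml.
have nT : retract (rep (R n)) (T (rep m \ox rep l)).
  apply: (retract_trans _ (iso_retract (ftens_isoT T (rep m) (rep l)))).
  by apply: (retract_trans nml); apply: retract_tens; exact: R_retract_T.
have [k nk] := local_retract_sum (rep_local hC _) (fmap_dsum_id T ip) nT.
exists (x k); first exact: (big_dsum_summand KS k xml).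
exact: prec_of_retract_T.
Qed.

(** R(n) is a summand of some R(a) (x) R(b), with R(a) in T(m) and R(b) in T(l).  All
    indecomposables in this product have length at most that of a plus that of b,
    while n has the length of m plus that of l; as a and b are either equal to m and
    l or strictly shorter, they are equal to them. *)
Lemma top_retract n m l :
  summand (rep n) (rep m \ox rep l) ->
  retract (rep (R n)) (rep (R m) \ox rep (R l)).
Proof.
move=> nml; have : retract (rep (R n)) (T (rep m) \ox T (rep l)).
  apply: (retract_trans _ (iso_retract (iso_sym (ftens_isoT T (rep m) (rep l))))).
  apply: retract_trans (R_retract_T n) _.
  by apply: fmap_retract; exact: summand_retract.
move=> /(local_retract_tens hC (rep_local hC _))[x [y []]].
have [a ->] := R_surj x; have [b ->] := R_surj y.
move=> /prec_of_retract_T am /prec_of_retract_T bl nab.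
have [k kab nk] := prec_of_retract_tens nab.
have := prec_ell hS nk; rewrite (ell_summand hS nml) (ell_summand hS kab).
have := prec_ell hS am; have := prec_ell hS bl.
have [ma|am'] := prec_eq_or_lt hS am; have [lb|bl'] := prec_eq_or_lt hS bl.
- by rewrite -ma -lb.
- by move=> _ _; rewrite ma leqNgt ltn_add2l bl'.
- by move=> _ _; rewrite lb leqNgt ltn_add2r am'.
- by move=> _ _; rewrite leqNgt (leq_trans _ (leq_add am' (ltnW bl'))) // addSn.
Qed.

Lemma thick_prec (I : Id C) l n : prec l n -> I (rep (R l)) -> I (rep (R n)).
Proof.
move=> [m nml] Il; apply: (thick_retract hC (top_retract nml)).
exact: thick_tens.
Qed.

(** * The generators of the spaces of invariants *)

(** A nonzero map whenever there is one; it then spans C(1, R(nu j)) by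
    [unit_gen_multiple]. *)
Definition unit_gen j : hom unit_ob (rep (R (nu j))) :=
  xget 0 [set f | f != 0].

Lemma unit_gen_neq0 j : with_invariants C (R (nu j)) -> unit_gen j != 0.
Proof. exact: xgetPex. Qed.

Lemma label_invariants j : L j -> with_invariants C (R (nu j)).
Proof. by move=> Lj; rewrite hnuB; exists j. Qed.

Lemma invariants_label x :
  with_invariants C x -> exists2 j, L j & R (nu j) = x.
Proof. by rewrite {1}hnuB. Qed.

Lemma dual_tens_retract n l :
  summand (rep n) (rep (phi l) \ox rep l) ->
  retract (rep (R n)) (dual (D (rep (R l))) \ox rep (R l)).
Proof.
move=> /top_retract /retract_trans; apply; apply: retract_tens.
  exact/iso_retract/iso_sym.
exact/iso_retract/iso_refl.
Qed.

Lemma unit_gen_multiple j (f : hom unit_ob (rep (R (nu j)))) :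
  L j -> exists a, f = unit_gen j \oc a.
Proof.
move=> Lj; have [[l lj] sc] := hd Lj.
apply: unit_map_multiple hk (sc _ lj) (dual_tens_retract lj) _ f.
exact/unit_gen_neq0/label_invariants.
Qed.

Lemma Ob_unit_gen (J : TId C) j l :
  L j -> Lambda_ j l -> Ob J (rep (R l)) <-> J _ _ (unit_gen j).
Proof.
move=> Lj lj; apply: Ob_unit_map hk ((hd Lj).2 _ lj) (dual_tens_retract lj) _ _.
exact/unit_gen_neq0/label_invariants.
Qed.

Lemma tid_unit_gen (J : TId C) j (f : hom unit_ob (rep (R (nu j)))) :
  L j -> f != 0 -> J _ _ f -> J _ _ (unit_gen j).
Proof.
move=> Lj f0; have [a fa] := unit_gen_multiple f Lj.
have a0 : a != 0 by apply: contraNneq f0 => a0; rewrite fa a0 comp0r.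
have [c ac] := unit_invertible hk a0.
move=> Jf; rewrite -[unit_gen j](comp_idl ac) -fa; exact: tid_compr.
Qed.

Lemma le_TId_unit_gen (J J' : TId C) :
  (forall j, L j -> J _ _ (unit_gen j) -> J' _ _ (unit_gen j)) -> le_TId J J'.
Proof.
move=> JJ'; apply: (le_TId_unit hC D) => x f Jf.
have [->|f0] := eqVneq f 0; first exact: tid0.
have [j Lj xj] := invariants_label (ex_intro _ f f0); case: x / xj f Jf f0 => f Jf f0.
have [a ->] := unit_gen_multiple f Lj.
by apply/tid_compr/JJ' => //; exact: tid_unit_gen Jf.
Qed.

(** * Tensor ideals and thick ideals *)

(** The objects R(l) with l in Lambda_j detect the generators, so an ideal is
    determined by its objects. *)
Lemma le_TId_of_Ob (J J' : TId C) : le_Id (Ob J) (Ob J') -> le_TId J J'.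
Proof.
move=> JJ'; apply: le_TId_unit_gen => j Lj.
have [[l lj] _] := hd Lj.
by move=> /(Ob_unit_gen J Lj lj)/JJ'/(Ob_unit_gen J' Lj lj).
Qed.

Lemma Ob_inj : injective (@Ob C).
Proof.
by move=> J J' e; apply: TId_eqP; apply: le_TId_of_Ob; rewrite e.
Qed.

Lemma Ob_poset_iso : poset_iso (@le_TId C) (@le_Id C) (@Ob C).
Proof.
have [addC _ _] := hC; split=> [|J J'].
  exists (factor_ideal addC) => [J|I]; last exact: Ob_factor_ideal.
  by apply: Ob_inj; exact: Ob_factor_ideal.
split=> [JJ' X|]; last exact: le_TId_of_Ob.
exact: JJ'.
Qed.

(** By [he], R(l') with l' in Lambda_j is a summand of a multiple of some R(l) with l in
    Lambda_i. *)
Lemma unit_gen_upward (J : TId C) i j :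
  L i -> L j -> (i <= j)%N -> J _ _ (unit_gen i) -> J _ _ (unit_gen j).
Proof.
move=> Li Lj; rewrite leq_eqVlt => /predU1P[->//|ij].
have [[l' l'j] _] := hd Lj; have [l [li [ll' _]]] := he Li Lj ij l'j.
move=> /(Ob_unit_gen J Li li) Jl; apply/(Ob_unit_gen J Lj l'j).
exact: thick_prec ll' Jl.
Qed.

Definition threshold_ideal i : TId C := principal_ideal (unit_gen i).

(** A nonzero composite f = h g_j, with h : R(nu j) -> R(nu i) and i < j, would
    generate g_j in turn: g_j = h' f = h' h g_j.  Then 1 - h' h kills g_j, so h' h is
    invertible in the local ring of R(nu j), which becomes a retract of R(nu i). *)
Lemma threshold_ideal_below i j (f : hom unit_ob (rep (R (nu i)))) :
  L i -> L j -> (i < j)%N -> threshold_ideal j _ _ f -> f = 0.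
Proof.
move=> Li Lj ij /principal_unitP[h fh].
have [//|f0] := eqVneq f 0; exfalso.
have /principal_unitP[h' gf] : principal_ideal f _ _ (unit_gen j).
  apply: (unit_gen_upward Li Lj (ltnW ij)).
  exact: tid_unit_gen Li f0 (principal_gen f).
have gj0 := unit_gen_neq0 (label_invariants Lj).
have [_ locj] := rep_local hC (R (nu j)).
have [[k [kh _]]|nh] := pselect (is_iso (h' \oc h)).
  have /(inde_retract_eq hC)/R_inj ji :
      retract (rep (R (nu j))) (rep (R (nu i))).
    by exists h, (k \oc h'); rewrite -kh compA.
  by have := hnu Li Lj ij; rewrite ji ltnn.
have [[k [kh _]]|nh'] := pselect (is_iso (idm _ - h' \oc h)).
  case/eqP: gj0; rewrite -[LHS]comp1m -kh -compA compDl comp1m compNl.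
  by rewrite -compA -fh -gf subrr comp0r.
apply: (locj _ _ nh nh'); rewrite addrC subrK; exact: is_iso_idm.
Qed.

Lemma threshold_idealP i j :
  L i -> L j -> threshold_ideal i _ _ (unit_gen j) <-> (i <= j)%N.
Proof.
move=> Li Lj; split=> [gj|ij]; last first.
  exact: unit_gen_upward ij (principal_gen _).
rewrite leqNgt; apply/negP => ji.
have /eqP := unit_gen_neq0 (label_invariants Lj); apply.
exact: threshold_ideal_below ji gj.
Qed.

(** If R(l) lies in the ideal, then its coevaluation has a nonzero component in
    some C(1, R(nu j)), and i <= j since it lies in the ideal too.  Now
    [hf] gives an element of Lambda_j below l, and [he] one of Lambda_i below that. *)
Lemma threshold_Ob i l :
  L i -> Ob (threshold_ideal i) (rep (R l)) <->
  exists m, Lambda_ i m /\ prec m l.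
Proof.
move=> Li; split=> [Jl|[m [mi ml]]]; last first.
  by apply: thick_prec ml _; apply/(Ob_unit_gen _ Li mi); exact: principal_gen.
have [l0 _] := rep_indecomposable (R l).
have [x [f [f0 Jf xl]]] := nonzero_unit_map hC D Jl l0.
have [j Lj xj] := invariants_label (ex_intro _ f f0); case: x / xj f f0 Jf xl => f f0 Jf jl.
have /threshold_idealP ij := tid_unit_gen Lj f0 Jf.
have [k kl jk] : exists2 k, summand (rep k) (rep (phi l) \ox rep l)
    & prec (nu j) k.
  apply: prec_of_retract_tens; apply: retract_trans jl _.
  apply: retract_tens; last exact/iso_retract/iso_refl.
  exact/iso_retract.
have [m [mj ml]] : exists m, Lambda_ j m /\ prec m l.
  by apply: hf => //; exists k.
have := ij Li Lj; rewrite leq_eqVlt => /predU1P[e|ij'].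
  by exists m; rewrite e.
have [m' [m'i [m'm _]]] := he Li Lj ij' mj.
exists m'; split=> //; exact: prec_trans hS _ _ _ m'm ml.
Qed.

(** A nonzero ideal contains some generator, and the least one determines it. *)
Lemma nonzero_threshold (J : TId C) :
  nonzero_Id (Ob J) -> exists2 i, L i & J = threshold_ideal i.
Proof.
move=> [X JX X0]; have [x [f [f0 Jf _]]] := nonzero_unit_map hC D JX X0.
have [j Lj xj] := invariants_label (ex_intro _ f f0); case: x / xj f f0 Jf => f f0 Jf.
have exJ : exists j, `[< L j /\ J _ _ (unit_gen j) >].
  by exists j; apply/asboolP; split=> //; exact: tid_unit_gen Jf.
case: (ex_minnP exJ) => i /asboolP[Li Ji] imin.
exists i => //. apply: TId_eqP; apply: le_TId_unit_gen => k Lk.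
  by move=> Jk; apply/threshold_idealP => //; apply: imin; apply/asboolP.
by move=> /(threshold_idealP Li Lk) ik; exact: unit_gen_upward ik Ji.
Qed.

Lemma threshold_nonzero i : L i -> nonzero_Id (Ob (threshold_ideal i)).
Proof.
move=> Li; have [[l li] _] := hd Li; exists (rep (R l)).
  by apply/(Ob_unit_gen _ Li li); exact: principal_gen.
by have [] := rep_indecomposable (R l).
Qed.

Lemma threshold_proper i j : L i -> L j -> (i < j)%N ->
  (Ob (threshold_ideal j) : set C) `<` (Ob (threshold_ideal i) : set C).
Proof.
move=> Li Lj ij; split=> [|ji].
  have le_ji : le_TId (threshold_ideal j) (threshold_ideal i).
    apply: le_TId_unit_gen => k Lk /(threshold_idealP Lj Lk) jk.
    by apply/threshold_idealP => //; exact: leq_trans (ltnW ij) jk.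
  by move=> X; exact: le_ji.
have [[l li] _] := hd Li.
have /ji/(Ob_unit_gen _ Li li)/(threshold_idealP Lj Li) :
    Ob (threshold_ideal i) (rep (R l)).
  by apply/(Ob_unit_gen _ Li li); exact: principal_gen.
by rewrite leqNgt ij.
Qed.

(** R(nu 0) is the unit object, so the generator with label 0 is invertible. *)
Lemma threshold0 X : Ob (threshold_ideal 0) X.
Proof.
have /(iso_of_retract (rep_neq0 hC _) (unit_local hk)) e :
    retract (rep (R (nu 0%N))) (unit_ob : C).
  apply: retract_trans (R_retract_T _) _.
  apply: (retract_trans (fmap_retract T (iso_retract nu0_unit))).
  apply: iso_retract; apply: iso_sym; exists (funit T); exact: funit_iso.
have [u [v [vu uv]]] := e.
have g0 : unit_gen 0 != 0.
  apply: unit_gen_neq0; exists v; apply: contraNneq (rep_neq0 hC (R (nu 0%N))).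
  by move=> v0; rewrite -vu v0 comp0l.
have u0 : u \oc unit_gen 0 != 0.
  apply: contraNneq g0 => ug.
  by rewrite -[unit_gen 0]comp1m -vu -compA ug comp0r.
have [_ _ /(_ _ u0)[w [wu _]]] := hk.
have J1 : Ob (threshold_ideal 0) unit_ob.
  by apply/principal_unitP; exists (w \oc u); rewrite -compA.
have X1 : iso (X \ox unit_ob) X.
  by exists (runit X), (runitV X); rewrite runitK runitVK.
by apply: (thick_iso X1); exact: thick_tens.
Qed.

Lemma unit_gen_scalar_iso j :
  L j -> scalar_iso (unit_ob : C) (rep (R (nu j))).
Proof.
move=> Lj; exists (fun a => unit_gen j \oc a); split.
- have [s gs] := choice (fun f => unit_gen_multiple f Lj).
  exists s => [a|f]; last by rewrite -gs.
  apply/eqP; rewrite -subr_eq0; apply/negP => /negP /(unit_invertible hk)[b ab].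
  have /eqP := unit_gen_neq0 (label_invariants Lj); apply.
  rewrite -[LHS]compm1 -ab compA compDr compNr -gs subrr.
  by rewrite comp0l.
- by move=> a b; rewrite compDr.
by move=> a b; rewrite scal_unit compA.
Qed.

Lemma threshold_values i j (J : TId C) : L i -> L j ->
  Ob J = Ob (threshold_ideal i) ->
  ((i <= j)%N -> J unit_ob (rep (R (nu j))) = setT) /\
  ((j < i)%N -> J unit_ob (rep (R (nu j))) = [set 0]).
Proof.
move=> Li Lj /Ob_inj ->; split=> [ij|ji]; apply/seteqP; split=> f //.
- move=> _; have [a ->] := unit_gen_multiple f Lj.
  by apply: tid_compr; apply/threshold_idealP.
- exact: threshold_ideal_below.
by move=> ->; exact: tid0.
Qed.

End Classification.

Theorem theorem4p4p4
  (S C : monoidalCat) (ell : inde S -> nat) (T : monoidalFunctor S C)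
  (D : right_rigid C) (R : inde S -> inde C) (phi : inde S -> inde S)
  (nu : nat -> inde S)
  (hS : l_controlled ell)
  (hC : krull_schmidt C) (hk : unit_field C)
  (hfg : forall X Y : C, fin_gen X Y)
  (B := with_invariants C) (L := label_set B)
  (Lambda_ := fun j : nat => dual_summand_set phi (nu j))
  (ha : bijective R /\
    forall l : inde S, exists X : C,
      is_dsum (rep (R l)) X (T (rep l)) /\
      forall m : inde S, summand (rep (R m)) X -> sprec m l)
  (hb : (forall l : inde S, ell (phi l) = ell l) /\
    forall l : inde S, iso (dual (D (rep (R l)))) (rep (R (phi l))))
  (hc : forall n n' : inde S,
    B (R n) -> B (R n') -> R n <> R n' -> ell n <> ell n')
  (hnuB : B = [set R (nu j) | j in L])
  (hnu0 : ell (nu 0%N) = 0%N)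
  (hnu : forall j j' : nat, L j -> L j' -> (j < j')%N ->
    (ell (nu j) < ell (nu j'))%N)
  (hd : forall j : nat, L j ->
    Lambda_ j !=set0 /\
    forall l : inde S, Lambda_ j l -> scalar_end (rep (R l)))
  (he : forall j j' : nat, L j -> L j' -> (j < j')%N ->
    forall l' : inde S, Lambda_ j' l' ->
    exists l : inde S, Lambda_ j l /\ sprec l l')
  (hf : forall (l : inde S) (j : nat), L j ->
    (exists k : inde S, prec (nu j) k /\
       summand (rep k) (rep (phi l) \ox rep l)) ->
    exists m : inde S, Lambda_ j m /\ prec m l) :
  poset_iso (@le_TId C) (@le_Id C) (@Ob C) /\
  exists I : nat -> Id C,
    [/\ [set K : Id C | nonzero_Id K] = [set I i | i in L],
        (forall X : C, I 0%N X),
        (forall i j : nat, L i -> L j -> (i < j)%N ->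
           (I j : set C) `<` (I i : set C)),
        (forall (i : nat) (l : inde S), L i ->
           (I i (rep (R l)) <-> exists m : inde S, Lambda_ i m /\ prec m l))
      & forall (i j : nat) (J : TId C), L i -> L j -> Ob J = I i ->
          ((i <= j)%N ->
             J unit_ob (rep (R (nu j))) = setT /\
             scalar_iso (unit_ob : C) (rep (R (nu j)))) /\
          ((j < i)%N -> J unit_ob (rep (R (nu j))) = [set 0])].
Proof.
have hphi := hb.2.
have iso_Ob := Ob_poset_iso hS hC hk ha hphi hnuB hnu0 hd.
split=> //; exists (fun i => Ob (threshold_ideal R nu i)); split.
- have [[F _ FK] _] := iso_Ob.
  apply/seteqP; split=> [K|_ [i Li <-]]; last first.
    exact: (threshold_nonzero hS hC hk ha hphi hnuB hnu0 hd).
  rewrite /= -(FK K) => /(nonzero_threshold hS hC hk ha hphi hnuB hnu0 hnu hd he).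
  by move=> [i Li ->]; exists i.
- exact: (threshold0 hS hC hk ha hnu0).
- exact: (threshold_proper hS hC hk ha hphi hnuB hnu0 hnu hd he).
- exact: (threshold_Ob hS hC hk ha hphi hnuB hnu0 hnu hd he hf).
move=> i j J Li Lj OJ.
have [le_ij lt_ji] :=
  threshold_values hS hC hk ha hphi hnuB hnu0 hnu hd he Li Lj OJ.
split=> // /le_ij ->; split=> //.
exact: (unit_gen_scalar_iso hS hC hk ha hphi hnuB hnu0 hd).
Qed.
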